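(* Let $\mathcal{A}$ be an o-minimal structure on the real field $(\mathbb{R},+,\cdot)$ that is not polynomially bounded. Let $X=X_{1}\cup X_{2}\subset\mathbb{R}^{3}$, where $$X_{1}=\{(x,ax^{a+1},x^{a+1}) : x>0,\ a\in\mathbb{R}\},\qquad X_{2}=\{(x,-ax^{a+1},x^{a+1}) : x>0,\ a\in\mathbb{R}\}.$$ Then $X$ is definable in $\mathcal{A}$ and the regular projection theorem fails for $X$: for every $p\in\mathbb{N}^{\ast}$, there do not exist $\varepsilon>0$, $C>0$ and a finite set $\{v_{1},\dots,v_{k}\}\subset\mathbb{R}^{2}$ such that for every $x\in\mathbb{R}^{3}$ there is $i\in\{1,\dots,k\}$ for which $\pi_{v_{i}}$ is $(\varepsilon,C,p)$-regular at $x$ with respect to $X$.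
   Context: ''Definable'' means definable in $\mathcal{A}$. $\mathcal{A}$ is polynomially bounded if for each definable function $f:\mathbb{R}\to\mathbb{R}$ there is $N\in\mathbb{N}$ such that $|f(x)|\leq x^{N}$ for all $x$ big enough. $\mathbb{N}^{\ast}$ is the set of positive integers. For $\lambda\in\mathbb{R}^{n-1}$, $\pi_{\lambda}:\mathbb{R}^{n}\to\mathbb{R}^{n-1}$ is the linear projection parallel to the vector $(\lambda,1)\in\mathbb{R}^{n}$. $B(v,r)$ is the open ball of center $v$ and radius $r$. For $x\in\mathbb{R}^{n}$, $v\in\mathbb{R}^{n-1}$, $\varepsilon>0$, put $$C_{\varepsilon}(x,v)=\{x+t(v',1) : t\in\mathbb{R}\setminus\{0\},\ v'\in B(v,\varepsilon)\}.$$ Let $\varepsilon,C>0$, $p\in\mathbb{N}^{\ast}$ and let $X\subset\mathbb{R}^n$ be definable. The projection $\pi_{\lambda}$ is called $(\varepsilon,C,p)$-regular at $x\in\mathbb{R}^{n}$ with respect to $X$ if: (1) the restriction $(\pi_{\lambda})_{|X}$ is finite (i.e. has finite fibres); (2) the set $X\cap C_{\varepsilon}(x,\lambda)$ is either empty or a finite disjoint union of sets of the form $A_{f_{i}}=\{x+f_{i}(\lambda')(\lambda',1) : \lambda'\in B(\lambda,\varepsilon)\}$, where the $f_{i}$ are non-vanishing real-valued $C^{p}$ functions defined on $B(\lambda,\varepsilon)$; (3) $\|\mathrm{grad}(f_{i})\|\leq C|f_{i}|$ on $B(\lambda,\varepsilon)$ for all $i$. *)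

(* Defs.v *)
From HB Require Import structures.
From mathcomp Require Import all_boot all_order all_algebra.
From mathcomp Require Import all_classical all_reals all_analysis.

Set Implicit Arguments.
Unset Strict Implicit.
Unset Printing Implicit Defensive.

Import Order.TTheory GRing.Theory Num.Theory.
Import numFieldNormedType.Exports.

Local Open Scope classical_set_scope.
Local Open Scope ring_scope.

(* [A n] is the collection of the definable subsets of R^n.  These are the
   axioms of van den Dries and Miller; [osA_interval] is an equivalence, so
   singletons of R are definable, and hence so is the zero set of every
   polynomial with real coefficients. *)
Record ominimal_structure (R : realType)
    (A : forall n : nat, set (set 'rV[R]_n)) : Prop := OMinimalStructure {
  osA_setT : forall n, A n setT ;
  osA_setC : forall n (X : set 'rV[R]_n), A n X -> A n (~` X) ;
  osA_setU : forall n (X Y : set 'rV[R]_n), A n X -> A n Y -> A n (X `|` Y) ;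
  osA_diag : forall n (i j : 'I_n), A n [set u | u 0 i = u 0 j] ;
  osA_prodl : forall n (X : set 'rV[R]_n),
    A n X -> A (1 + n)%N [set u | X (rsubmx u)] ;
  osA_prodr : forall n (X : set 'rV[R]_n),
    A n X -> A (n + 1)%N [set u | X (lsubmx u)] ;
  osA_proj : forall n (X : set 'rV[R]_(n + 1)),
    A (n + 1)%N X -> A n [set lsubmx u | u in X] ;
  osA_add : A 3%N [set u | u 0 0 + u 0 1 = u 0 2%:R] ;
  osA_mul : A 3%N [set u | u 0 0 * u 0 1 = u 0 2%:R] ;
  (* an [interval R] may be a single point, empty or unbounded *)
  osA_interval : forall X : set 'rV[R]_1,
    A 1%N X <->
    exists s : seq (interval R),
      X = [set u | exists2 I : interval R, I \in s & u 0 0 \in I]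
}.

Definition definable_function (R : realType)
    (A : forall n : nat, set (set 'rV[R]_n)) (f : R -> R) : Prop :=
  A 2%N [set u | u 0 1 = f (u 0 0)].

Definition polynomially_bounded (R : realType)
    (A : forall n : nat, set (set 'rV[R]_n)) : Prop :=
  forall f : R -> R, definable_function A f ->
    exists N : nat, \forall x \near +oo, `|f x| <= x ^+ N.

(* The library's norm on ['rV[R]_m] is the sup norm. *)
Definition enorm (R : realType) (m : nat) (u : 'rV[R]_m) : R :=
  Num.sqrt (\sum_(j < m) u 0 j ^+ 2).

Definition eball (R : realType) (m : nat) (v : 'rV[R]_m) (r : R) :
    set 'rV[R]_m :=
  [set w | enorm (w - v) < r].

Definition partial (R : realType) (m : nat) (j : 'I_m) (f : 'rV[R]_m -> R) :
    'rV[R]_m -> R :=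
  fun u => 'D_(delta_mx 0 j) f u.

Definition grad (R : realType) (m : nat) (f : 'rV[R]_m -> R) (u : 'rV[R]_m) :
    'rV[R]_m :=
  \row_j partial j f u.

(* [f] is of class C^p on [U], for an open [U]; the values of [f] outside [U]
   are irrelevant. *)
Fixpoint class_C (R : realType) (m : nat) (U : set 'rV[R]_m) (p : nat)
    (f : 'rV[R]_m -> R) : Prop :=
  match p with
  | 0%N => forall u, U u -> {for u, continuous f}
  | q.+1 => (forall u, U u -> {for u, continuous f}) /\
            forall j : 'I_m,
              (forall u, U u -> derivable f u (delta_mx 0 j)) /\
              class_C U q (partial j f)
  end.

(* The vector (v, 1). *)
Definition dir (R : realType) (m : nat) (v : 'rV[R]_m) : 'rV[R]_(m + 1) :=
  row_mx v 1%:M.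

(* The kernel is the line spanned by [dir l], and R^m, identified with
   R^m x {0}, is fixed pointwise. *)
Definition proj_along (R : realType) (m : nat) (l : 'rV[R]_m)
    (x : 'rV[R]_(m + 1)) : 'rV[R]_m :=
  lsubmx x - (rsubmx x) 0 0 *: l.

Definition cone (R : realType) (m : nat) (eps : R) (x : 'rV[R]_(m + 1))
    (v : 'rV[R]_m) : set 'rV[R]_(m + 1) :=
  [set y | exists t : R, exists v' : 'rV[R]_m,
     [/\ t != 0, eball v eps v' & y = x + t *: dir v']].

(* The set A_f. *)
Definition cone_graph (R : realType) (m : nat) (eps : R)
    (x : 'rV[R]_(m + 1)) (l : 'rV[R]_m) (f : 'rV[R]_m -> R) :
    set 'rV[R]_(m + 1) :=
  [set x + f l' *: dir l' | l' in eball l eps].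

(* The case [k = 0] is the one where X does not meet the cone. *)
Definition regular_projection (R : realType) (m : nat) (eps C : R) (p : nat)
    (X : set 'rV[R]_(m + 1)) (x : 'rV[R]_(m + 1)) (l : 'rV[R]_m) : Prop :=
  (forall y : 'rV[R]_m, finite_set (X `&` proj_along l @^-1` [set y])) /\
  exists (k : nat) (f : 'I_k -> 'rV[R]_m -> R),
    [/\ forall i, class_C (eball l eps) p (f i),
        forall i l', eball l eps l' -> f i l' != 0,
        trivIset setT (fun i => cone_graph eps x l (f i)),
        X `&` cone eps x l = \bigcup_i cone_graph eps x l (f i) &
        forall i l', eball l eps l' ->
          enorm (grad (f i) l') <= C * `|f i l'|].

Definition point3 (R : realType) (x y z : R) : 'rV[R]_(2 + 1) :=
  \row_(i < 2 + 1) [:: x; y; z]`_i.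

Definition X1 (R : realType) : set 'rV[R]_(2 + 1) :=
  [set u | exists x a : R,
     0 < x /\ u = point3 x (a * x `^ (a + 1)) (x `^ (a + 1))].

Definition X2 (R : realType) : set 'rV[R]_(2 + 1) :=
  [set u | exists x a : R,
     0 < x /\ u = point3 x (- a * x `^ (a + 1)) (x `^ (a + 1))].

(* Main.v *)
Require Import Defs.
From HB Require Import structures.
From mathcomp Require Import all_boot all_order all_algebra.
From mathcomp Require Import all_classical all_reals all_analysis.
From mathcomp Require Import lra ring zify.

Set Implicit Arguments.
Unset Strict Implicit.
Unset Printing Implicit Defensive.

Import Order.TTheory GRing.Theory Num.Theory.
Import numFieldNormedType.Exports.

Local Open Scope classical_set_scope.
Local Open Scope ring_scope.

(** The proof has two independent parts.

    Definability.  The set X consists of the points (x, y, z) with x, z > 0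
    and y ln x = z (ln z - ln x) or - y ln x = z (ln z - ln x)
    ([surfaceE]), so it suffices that the logarithm is definable
    ([ln_definable]).  This is Miller's dichotomy, proved by comparing
    increments.  A definable subset of the line contains a neighbourhood of
    +oo or misses one ([definable_germ]); hence some definable f eventually exceeds every power
    of x, and its generalised inverse g is a definable nondecreasing function
    that tends to +oo more slowly than every positive power of t.  Put
    k_b(t) = g(b t) - g(t) for b > 1.  By o-minimality the ratio
    k_b(b t) / k_b(t) eventually stays on one side of each constant c: staying
    above some c > 1 would make g grow like a power of t, and staying below
    some c < 1 would make g bounded.  So the ratio tends to 1
    ([incr_ratio_cvg1]), by telescoping k_(b^n) / k_b tends to n
    ([incr_exp_cvg]), and comparing powers of y with powers of 2 gives
    k_y / k_2 --> ln y / ln 2 ([incr_cvg_log]), a first-order description of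
    the logarithm in terms of g.

    Failure of regularity.  Let P = (x0, 0, 0) with x0 > 0 small and let
    (v1, v2) be a direction.  On X the third coordinate is positive, and
    P + t (v1, b, 1) lies on X when t = (x0 + t v1)^(1 + b) or
    t = (x0 + t v1)^(1 - b).  If b is nonzero, one of these two exponents is
    1 + |b| > 1, and for that exponent there is a solution t close to
    x0^(1 + |b|), negligible with respect to x0.  As b varies,
    ln t changes at a rate close to ln x0, which is unbounded as x0 --> 0,
    while the gradient bound makes ln t Lipschitz in b with constant C.  Hence
    no projection is regular at P once x0 is small enough
    ([irregular_near]), and finitely many directions admit a common x0
    ([irregular]). *)

(** * First-order definability *)
Section Environments.
Context {R : realType}.
Implicit Types (e : nat -> R).

(** Padding by 0 makes the points of all the spaces R^n valuations of the same
    type, so that statements about different n need no cast. *)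
Definition env (n : nat) (u : 'rV[R]_n) : nat -> R :=
  fun i => oapp (u 0) 0 (insub i).

Definition upd e (n : nat) (x : R) : nat -> R :=
  fun i => if i == n then x else e i.

Lemma env_ord n (u : 'rV[R]_n) (i : 'I_n) : env u i = u 0 i.
Proof. by rewrite /env valK. Qed.

Lemma env_ge n (u : 'rV[R]_n) i : (n <= i)%N -> env u i = 0.
Proof. by move=> le_ni; rewrite /env insubF // ltnNge le_ni. Qed.

Lemma env_rsubmx n (u : 'rV[R]_(1 + n)) : env (rsubmx u) = fun i => env u i.+1.
Proof.
apply/funext => i; have [lt_in|le_ni] := ltnP i n; last by rewrite !env_ge.
rewrite -[i in LHS]/(val (Ordinal lt_in)) env_ord mxE.
by rewrite -env_ord.
Qed.

Lemma env_lsubmx n (u : 'rV[R]_(n + 1)) :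
  env u = upd (env (lsubmx u)) n (env u n).
Proof.
apply/funext => i; rewrite /upd; case: eqP => [-> //|/eqP ne_in].
have [lt_in|le_ni] := ltnP i n; last first.
  by rewrite [RHS]env_ge // env_ge // addn1 ltn_neqAle eq_sym ne_in.
rewrite -[i in RHS]/(val (Ordinal lt_in)) env_ord mxE.
by rewrite -env_ord.
Qed.

End Environments.

Section Calculus.
Context {R : realType} {A : forall n : nat, set (set 'rV[R]_n)}.
Hypothesis omin : ominimal_structure A.
Implicit Types (e : nat -> R) (P Q : (nat -> R) -> Prop) (t : (nat -> R) -> R).

Definition definable_pred n P := A [set u : 'rV[R]_n | P (env u)].

Lemma eq_definable n P Q : (forall e, P e <-> Q e) ->
  definable_pred n P -> definable_pred n Q.
Proof.
by move=> eqPQ; congr (A _); apply/seteqP; split=> u /=; rewrite eqPQ.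
Qed.

Lemma definable_not n P : definable_pred n P -> definable_pred n (fun e => ~ P e).
Proof. exact: (osA_setC omin). Qed.

Lemma definable_or n P Q : definable_pred n P -> definable_pred n Q ->
  definable_pred n (fun e => P e \/ Q e).
Proof. exact: (osA_setU omin). Qed.

Lemma definable_and n P Q : definable_pred n P -> definable_pred n Q ->
  definable_pred n (fun e => P e /\ Q e).
Proof.
move=> dP dQ; have := definable_or (definable_not dP) (definable_not dQ).
move=> /definable_not; apply: eq_definable => e.
by rewrite not_orP !not_notE.
Qed.

Lemma definable_var n i j : (i < n)%N -> (j < n)%N ->
  definable_pred n (fun e => e i = e j).
Proof.
move=> lt_in lt_jn; have := osA_diag omin (Ordinal lt_in) (Ordinal lt_jn).
by congr (A _); apply/seteqP; split=> u /=; rewrite -!env_ord.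
Qed.

Lemma definable_shift m n P :
  definable_pred n P -> definable_pred (m + n)%N (fun e => P (fun i => e (m + i)%N)).
Proof.
move=> dP; elim: m => [//|m IHm].
have := osA_prodl omin IHm; congr (A _).
by apply/seteqP; split=> u /=; rewrite env_rsubmx.
Qed.

Lemma definable_ex n P :
  definable_pred n.+1 P -> definable_pred n (fun e => exists x, P (upd e n x)).
Proof.
rewrite -addn1 => /(osA_proj omin); congr (A _).
apply/seteqP; split=> [_ [u Pu <-]|u [x Pux]] /=.
  by exists (env u n); rewrite -env_lsubmx.
exists (row_mx u x%:M); last by rewrite row_mxKl.
rewrite /= env_lsubmx row_mxKl; suff -> : env (row_mx u x%:M) n = x by [].
have <- : env (row_mx u x%:M) (rshift n (0 : 'I_1)) = env (row_mx u x%:M) n.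
  by rewrite /= addn0.
by rewrite env_ord row_mxEr mxE eqxx mulr1n //.
Qed.

(** The graph is required to be definable in every larger context: this builds
    weakening in, and locality makes the value of [t] insensitive to the
    variables that a quantifier adds. *)
Definition definable_term n t :=
  (forall e e', (forall i, (i < n)%N -> e i = e' i) -> t e = t e') /\
  (forall k j, (n <= k)%N -> (j < k)%N -> definable_pred k (fun e => t e = e j)).

Lemma definable_term_var n i : (i < n)%N -> definable_term n (fun e => e i).
Proof.
move=> lt_in; split=> [e e' -> //|k j le_nk lt_jk].
exact: definable_var (leq_trans lt_in le_nk) lt_jk.
Qed.

Lemma definable_term_widen m n t : (m <= n)%N ->
  definable_term m t -> definable_term n t.
Proof.
move=> le_mn [loc dt]; split=> [e e' ee'|k j le_nk].
  by apply: loc => i lt_im; rewrite ee' // (leq_trans lt_im).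
by apply: dt; rewrite (leq_trans le_mn).
Qed.

(** Adjoin m new variables carrying the values of the terms, then eliminate
    them one at a time by projection, the last one first. *)
Lemma definable_comp m n (ts : nat -> (nat -> R) -> R) P :
  (forall i, (i < m)%N -> definable_term n (ts i)) -> definable_pred m P ->
  definable_pred n (fun e => P (fun i => if (i < m)%N then ts i e else 0)).
Proof.
move=> dts /(definable_shift n).
set Q := (Q in definable_pred (n + m) Q) => dQ.
suff: definable_pred n (fun e => Q (fun i => if (i < n)%N then e i else
              if (i < n + m)%N then ts (i - n)%N e else 0)).
  apply: eq_definable => e; rewrite /Q.
  set e1 := fun i : nat => _; set e2 := fun i : nat => _.
  suff -> : e1 = e2 by [].
  apply/funext => i.
  by rewrite /e1 /e2 ltnNge leq_addr /= ltn_add2l addnC addnK.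
clearbody Q; elim: m Q dts dQ => [|m IHm] Q dts.
  rewrite addn0; congr (A _); apply/seteqP.
  by split=> u /=; congr Q; apply/funext => i; case: ltnP => // /env_ge ->.
have [loc dt] := dts m (ltnSn m).
rewrite addnS => dQ.
have /IHm : definable_pred (n + m) (fun e => Q (upd e (n + m)%N (ts m e))).
  have dm := dt _ (n + m)%N (leqW (leq_addr m n)) (ltnSn _).
  apply: eq_definable (definable_ex (definable_and dQ dm)) => e.
  have locm x : ts m (upd e (n + m)%N x) = ts m e.
    apply: loc => i lt_in; rewrite /upd; case: eqP => // eq_i.
    by move: lt_in; rewrite eq_i ltnNge leq_addr.
  split=> [[x [Qx]]|Qe]; first by rewrite locm /upd eqxx => ->.
  by exists (ts m e); split=> //; rewrite locm /upd eqxx.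
move=> dQ'; apply: eq_definable (dQ' _) => [e|i lt_im]; last by apply: dts; rewrite ltnW.
set e1 := fun i : nat => if (i < n)%N then _ else if (i < n + m)%N then _ else _.
have -> : ts m e1 = ts m e by apply: loc => i lt_in; rewrite /e1 lt_in.
set e2 := fun i : nat => _.
suff -> : upd e1 (n + m)%N (ts m e) = e2 by [].
apply/funext => i; rewrite /upd /e1 /e2; case: eqP => [->|/eqP ne_i].
  by rewrite ltnNge leq_addr /= ltnSn addnC addnK.
by rewrite (ltnS i (n + m)) (leq_eqVlt i) (negPf ne_i).
Qed.

Lemma definable_rel1 n (r : R -> Prop) t : definable_pred 1 (fun e => r (e 0%N)) ->
  definable_term n t -> definable_pred n (fun e => r (t e)).
Proof. by move=> dr dt; exact: (@definable_comp 1 n (fun=> t) _ _ dr). Qed.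

Lemma definable_rel2 n (r : R -> R -> Prop) t1 t2 :
  definable_pred 2 (fun e => r (e 0%N) (e 1%N)) ->
  definable_term n t1 -> definable_term n t2 ->
  definable_pred n (fun e => r (t1 e) (t2 e)).
Proof.
move=> dr d1 d2; apply: (@definable_comp 2 n (fun i => if i is 0%N then t1 else t2) _ _ dr).
by case.
Qed.

Lemma definable_rel3 n (r : R -> R -> R -> Prop) t1 t2 t3 :
  definable_pred 3 (fun e => r (e 0%N) (e 1%N) (e 2%N)) ->
  definable_term n t1 -> definable_term n t2 -> definable_term n t3 ->
  definable_pred n (fun e => r (t1 e) (t2 e) (t3 e)).
Proof.
move=> dr d1 d2 d3.
apply: (@definable_comp 3 n (fun i => match i with 0%N => t1 | 1%N => t2 | _ => t3 end) _ _ dr).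
by move=> [|[|i]].
Qed.

Lemma definable_interval (I : interval R) : definable_pred 1 (fun e => e 0%N \in I).
Proof.
apply/(osA_interval omin); exists [:: I]; apply/seteqP; split=> u /=.
  by rewrite -[0%N]/(val (0 : 'I_1)) env_ord => uI; exists I => //; rewrite inE.
by rewrite -[0%N]/(val (0 : 'I_1)) env_ord => -[J]; rewrite inE => /eqP ->.
Qed.

Lemma definable_term_cst n c : definable_term n (fun=> c).
Proof.
split=> // k j _ lt_jk.
apply: (@definable_rel1 k (fun x => c = x) (fun e => e j)); last exact: definable_term_var.
apply: eq_definable (definable_interval `[c, c]) => e.
by rewrite in_itv /= -eq_le; split=> [/eqP|->].
Qed.

Lemma definable_add : definable_pred 3 (fun e => e 0%N + e 1%N = e 2%N).
Proof.
have := osA_add omin; congr (A _).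
by apply/seteqP; split=> u /=; rewrite -!env_ord.
Qed.

Lemma definable_mul : definable_pred 3 (fun e => e 0%N * e 1%N = e 2%N).
Proof.
have := osA_mul omin; congr (A _).
by apply/seteqP; split=> u /=; rewrite -!env_ord.
Qed.

Lemma definable_term_add n t1 t2 : definable_term n t1 -> definable_term n t2 ->
  definable_term n (fun e => t1 e + t2 e).
Proof.
move=> d1 d2; split=> [e e' ee'|k j le_nk lt_jk].
  by rewrite (d1.1 _ _ ee') (d2.1 _ _ ee').
exact: (definable_rel3 (r := fun x y z => x + y = z) definable_add
  (definable_term_widen le_nk d1) (definable_term_widen le_nk d2) (definable_term_var lt_jk)).
Qed.

Lemma definable_term_mul n t1 t2 : definable_term n t1 -> definable_term n t2 ->
  definable_term n (fun e => t1 e * t2 e).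
Proof.
move=> d1 d2; split=> [e e' ee'|k j le_nk lt_jk].
  by rewrite (d1.1 _ _ ee') (d2.1 _ _ ee').
exact: (definable_rel3 (r := fun x y z => x * y = z) definable_mul
  (definable_term_widen le_nk d1) (definable_term_widen le_nk d2) (definable_term_var lt_jk)).
Qed.

Lemma definable_graph g : definable_function A g ->
  definable_pred 2 (fun e => e 1%N = g (e 0%N)).
Proof.
by congr (A _); apply/seteqP; split=> u /=; rewrite -!env_ord.
Qed.

Lemma definable_term_app n g t :
  definable_function A g -> definable_term n t -> definable_term n (fun e => g (t e)).
Proof.
move=> dg dt; split=> [e e' ee'|k j le_nk lt_jk]; first by rewrite (dt.1 _ _ ee').
have := definable_rel2 (r := fun x y => y = g x) (definable_graph dg)
  (definable_term_widen le_nk dt) (definable_term_var lt_jk).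
by apply: eq_definable => e; split=> ->.
Qed.

Lemma definable_eq n t1 t2 : definable_term n t1 -> definable_term n t2 ->
  definable_pred n (fun e => t1 e = t2 e).
Proof. exact: (definable_rel2 (r := fun x y => x = y) (definable_var (n := 2) _ _)). Qed.

Lemma definable_lt n t1 t2 : definable_term n t1 -> definable_term n t2 ->
  definable_pred n (fun e => t1 e < t2 e).
Proof.
move=> d1 d2; have d0 : definable_pred 1 (fun e => 0 < e 0%N).
  by apply: eq_definable (definable_interval `]0, +oo[) => e; rewrite in_itv /= andbT.
have := definable_rel1 (r := fun x => 0 < x) d0
  (definable_term_add d2 (definable_term_mul (definable_term_cst n (- 1)) d1)).
by apply: eq_definable => e; rewrite mulN1r subr_gt0.
Qed.

(** Formulas of the language of rings with a symbol for each real constant and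
    for each definable function.  Variables are numbered from the outside:
    a quantifier in the scope of n variables binds the variable n. *)
Inductive lterm :=
  | TVar of nat
  | TCst of R
  | TAdd of lterm & lterm
  | TMul of lterm & lterm
  | TApp of (R -> R) & lterm.

Inductive lformula :=
  | FEq of lterm & lterm
  | FLt of lterm & lterm
  | FNot of lformula
  | FAnd of lformula & lformula
  | FOr of lformula & lformula
  | FEx of lformula.

Fixpoint eval e (s : lterm) : R :=
  match s with
  | TVar i => e i
  | TCst c => c
  | TAdd s1 s2 => eval e s1 + eval e s2
  | TMul s1 s2 => eval e s1 * eval e s2
  | TApp g s1 => g (eval e s1)
  end.

Fixpoint holds n e (f : lformula) : Prop :=
  match f with
  | FEq s1 s2 => eval e s1 = eval e s2
  | FLt s1 s2 => eval e s1 < eval e s2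
  | FNot f1 => ~ holds n e f1
  | FAnd f1 f2 => holds n e f1 /\ holds n e f2
  | FOr f1 f2 => holds n e f1 \/ holds n e f2
  | FEx f1 => exists x, holds n.+1 (upd e n x) f1
  end.

Fixpoint wf_term n (s : lterm) : Prop :=
  match s with
  | TVar i => (i < n)%N
  | TCst _ => True
  | TAdd s1 s2 | TMul s1 s2 => wf_term n s1 /\ wf_term n s2
  | TApp g s1 => definable_function A g /\ wf_term n s1
  end.

Fixpoint wf_formula n (f : lformula) : Prop :=
  match f with
  | FEq s1 s2 | FLt s1 s2 => wf_term n s1 /\ wf_term n s2
  | FNot f1 => wf_formula n f1
  | FAnd f1 f2 | FOr f1 f2 => wf_formula n f1 /\ wf_formula n f2
  | FEx f1 => wf_formula n.+1 f1
  end.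

Lemma definable_term_eval n s : wf_term n s -> definable_term n (eval^~ s).
Proof.
elim: s => [i|c|s1 IH1 s2 IH2|s1 IH1 s2 IH2|g s1 IH1] /=.
- exact: definable_term_var.
- by move=> _; exact: definable_term_cst.
- by move=> [/IH1 d1 /IH2]; exact: definable_term_add.
- by move=> [/IH1 d1 /IH2]; exact: definable_term_mul.
- by move=> [dg /IH1]; exact: definable_term_app.
Qed.

(** Every definability claim below amounts to exhibiting a formula. *)
Lemma definable_formula n f : wf_formula n f -> definable_pred n (fun e => holds n e f).
Proof.
elim: f n => [s1 s2|s1 s2|f IH|f1 IH1 f2 IH2|f1 IH1 f2 IH2|f IH] n /=.
- by move=> [/definable_term_eval d1 /definable_term_eval]; exact: definable_eq.
- by move=> [/definable_term_eval d1 /definable_term_eval]; exact: definable_lt.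
- by move=> /IH; exact: definable_not.
- by move=> [/IH1 d1 /IH2]; exact: definable_and.
- by move=> [/IH1 d1 /IH2]; exact: definable_or.
- by move=> /IH; exact: definable_ex.
Qed.

End Calculus.

Arguments lterm R : clear implicits.
Arguments lformula R : clear implicits.
Arguments wf_formula {R} A n f.
Arguments definable_pred {R} A n P.

(** * Slowly growing functions and the logarithm *)
Section Growth.
Context {R : realType}.
Implicit Types (b c t x y : R) (n : nat).

Lemma near_pinfty_from (Q : R -> Prop) M : (\forall t \near +oo, Q t) ->
  exists2 t0 : R, M < t0 & forall t, t0 <= t -> Q t.
Proof.
move=> [T [_ QT]]; exists (Num.max T M + 1); first by rewrite ltr_pwDr // le_max lexx orbT.
move=> t le_t; apply: QT; apply: lt_le_trans le_t.
by rewrite ltr_pwDr // le_max lexx.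
Qed.

Lemma near_pinfty_scale b (Q : R -> Prop) : 0 < b ->
  (\forall t \near +oo, Q t) -> \forall t \near +oo, Q (b * t).
Proof.
by move=> b0; apply: (@gt0_cvgMry R +oo _ b id b0 (fun A => id)).
Qed.

Lemma expr_unbounded b M : 1 < b -> exists n, M < b ^+ n.
Proof.
move=> b1; have lnb : 0 < ln b by rewrite ln_gt0.
have b0 : 0 < b by rewrite (lt_trans ltr01).
have [M0|M0] := leP M 0; first by exists 0%N; rewrite expr0; lra.
exists (Num.bound (ln M / ln b)).
rewrite -ltr_ln ?posrE ?exprn_gt0 // lnXn // -mulr_natr mulrC -ltr_pdivrMr //.
exact: unstable.ltr_bound.
Qed.

Variable g : R -> R.

Definition incr b t := g (b * t) - g t.

Hypothesis g_nd : {homo g : x y / x <= y}.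
Hypothesis g_unbounded : forall M, exists t, M < g t.
Hypothesis g_slow : forall N, \forall t \near +oo, g t ^+ N <= t.
(** O-minimality enters through this alternative alone. *)
Hypothesis g_tame : forall b c d,
  (\forall t \near +oo, c * incr b t < d * incr b (b * t)) \/
  (\forall t \near +oo, d * incr b (b * t) <= c * incr b t).

Lemma g_pos : \forall t \near +oo, 0 < g t.
Proof.
have [t0 gt0] := g_unbounded 0; near=> t.
by apply: lt_le_trans gt0 (g_nd _); near: t; apply: nbhs_pinfty_ge; rewrite num_real.
Unshelve. all: by end_near. Qed.

Lemma incr_ge0 b t : 1 < b -> 0 <= t -> 0 <= incr b t.
Proof. by move=> b1 t0; rewrite subr_ge0 g_nd // ler_peMl // ltW. Qed.

Lemma g_unbounded_geom b t M : 1 < b -> 0 < t -> exists n, M < g (b ^+ n * t).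
Proof.
move=> b1 t0; have [s Mgs] := g_unbounded M.
have [n lt_n] := expr_unbounded (s / t) b1.
exists n; apply: lt_le_trans Mgs (g_nd _).
by rewrite -ler_pdivrMr // ltW.
Qed.

Lemma le_geom b t n : 1 < b -> 0 < t -> t <= b ^+ n * t.
Proof. by move=> b1 t0; rewrite ler_peMl ?(ltW t0) // exprn_ege1 // ltW. Qed.

(** Otherwise g is constant along a geometric progression. *)
Lemma incr_gt0 b : 1 < b -> \forall t \near +oo, 0 < incr b t.
Proof.
move=> b1; have [near_gt|near_le] := g_tame b (- 1) 0.
  by near=> t; have : -1 * incr b t < 0 * incr b (b * t) by [near: t|]; rewrite ?mul0r; lra.
have [t0 t0_gt le_t0] := near_pinfty_from 0 near_le.
have [n] := g_unbounded_geom (g t0) b1 t0_gt.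
suff -> : g (b ^+ n * t0) = g t0 by rewrite ltxx.
elim: n => [|n IHn]; first by rewrite mul1r.
have le_n := le_geom n b1 t0_gt.
have := le_t0 _ le_n.
have := incr_ge0 b1 (le_trans (ltW t0_gt) le_n).
rewrite /incr !mulrA -exprS IHn; lra.
Unshelve. all: by end_near. Qed.

(** Otherwise [c ^+ n * incr b t0 <= incr b (b ^+ n * t0)] for all n, so g grows
    at least like the power [ln c / ln b] of t. *)
Lemma incr_ratio_lt b c : 1 < b -> 1 < c ->
  \forall t \near +oo, incr b (b * t) < c * incr b t.
Proof.
move=> b1 c1; have b0 : 0 < b by lra.
have [near_lt|near_le] := g_tame b (- c) (- 1).
  by near=> t; have : -c * incr b t < -1 * incr b (b * t) by [near: t|]; lra.
have [|t0 t0_gt le_t0] := @near_pinfty_from (fun t => [/\ - 1 * incr b (b * t) <= - c * incr b t,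
  0 < incr b t & 0 < g t]) 0.
  by near=> t; split; near: t; [exact: near_le|exact: incr_gt0|exact: g_pos].
have [_ h0 g0] := le_t0 _ (lexx _).
have growth n : c ^+ n * incr b t0 <= incr b (b ^+ n * t0).
  elim: n => [|n IHn]; first by rewrite !mul1r.
  have [+ _ _] := le_t0 _ (le_geom n b1 t0_gt).
  rewrite mulrA -!exprS => le_n.
  rewrite exprS -mulrA; apply: le_trans (_ : c * incr b (b ^+ n * t0) <= _); last by lra.
  by rewrite ler_pM2l //; lra.
(* The N-th power of g grows at least like t^2 along the progression. *)
exfalso; have [N ltN] := expr_unbounded (b * b) c1.
have [t1 t1_gt le_t1] := near_pinfty_from 0 (g_slow N).
have [n1 lt_n1] := expr_unbounded (t1 / t0) b1.
have [n2 lt_n2] := expr_unbounded (b * t0 / incr b t0 ^+ N) b1.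
pose n := (n1 + n2)%N.
have : g (b ^+ n.+1 * t0) ^+ N <= b ^+ n.+1 * t0.
  apply: le_t1; rewrite -ler_pdivrMr // (le_trans (ltW lt_n1)) //.
  by rewrite ler_weXn2l ?(ltW b1) // /n; lia.
move=> /le_lt_trans le_slow; suff /le_slow : b ^+ n.+1 * t0 < g (b ^+ n.+1 * t0) ^+ N.
  by rewrite ltxx.
apply: lt_le_trans (_ : (c ^+ n * incr b t0) ^+ N <= _); last first.
  apply: lerXn2r; rewrite ?nnegrE.
  - by rewrite mulr_ge0 ?exprn_ge0 ?ltW //; lra.
  - have [_ _ /ltW //] := le_t0 _ (le_geom n.+1 b1 t0_gt).
  have := growth n; have [_ _] := le_t0 _ (le_geom n b1 t0_gt).
  by rewrite /incr mulrA -exprS; lra.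
rewrite exprMn -exprM mulnC exprM.
apply: lt_le_trans (_ : (b * b) ^+ n * incr b t0 ^+ N <= _); last first.
  rewrite ler_pM2r ?exprn_gt0 //; apply: lerXn2r; rewrite ?nnegrE ?(ltW ltN) //.
    by rewrite mulr_ge0 ?ltW.
  by rewrite exprn_ge0 // ltW //; lra.
rewrite exprMn exprSr -!mulrA ltr_pM2l ?exprn_gt0 //.
rewrite -ltr_pdivrMr ?exprn_gt0 //.
by apply: lt_le_trans lt_n2 _; rewrite ler_weXn2l ?(ltW b1) // /n; lia.
Unshelve. all: by end_near. Qed.

(** Otherwise [g t + incr b t / (1 - c)] does not increase along the
    progression [b ^+ n * t0], so g is bounded. *)
Lemma incr_ratio_gt b c : 1 < b -> 0 < c -> c < 1 ->
  \forall t \near +oo, c * incr b t < incr b (b * t).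
Proof.
move=> b1 c0 c1; have [near_lt|near_le] := g_tame b c 1.
  by near=> t; rewrite -[ltRHS]mul1r; near: t.
exfalso; have [t0 t0_gt le_t0] := near_pinfty_from 0 near_le.
pose d := (1 - c)^-1; have d0 : 0 < d by rewrite invr_gt0 subr_gt0.
have [n] := g_unbounded_geom (g t0 + d * incr b t0) b1 t0_gt.
suff : g (b ^+ n * t0) + d * incr b (b ^+ n * t0) <= g t0 + d * incr b t0.
  have : 0 <= d * incr b (b ^+ n * t0).
    by rewrite mulr_ge0 ?(ltW d0) // incr_ge0 // (le_trans (ltW t0_gt)) // le_geom.
  lra.
elim: n => [|n IHn]; first by rewrite !mul1r.
apply: le_trans IHn; rewrite exprS -!mulrA.
set s := b ^+ n * t0; have le_s : t0 <= s by exact: le_geom.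
have := le_t0 _ le_s; rewrite mul1r => le_cs.
have -> : g (b * s) = g s + incr b s by rewrite /incr; ring.
have dE : d * (1 - c) = 1 by rewrite mulVf // subr_eq0 gt_eqF.
have : d * incr b (b * s) <= d * (c * incr b s) by rewrite ler_pM2l.
have -> : d * (c * incr b s) = d * incr b s - incr b s.
  by rewrite -[X in _ - X]mul1r -dE; ring.
lra.
Unshelve. all: by end_near. Qed.

Lemma incr_ratio_cvg1 b : 1 < b -> incr b (b * t) / incr b t @[t --> +oo] --> (1 : R).
Proof.
move=> b1; apply/cvgrPdist_lt => eps eps0.
pose del := Num.min eps 2^-1.
have del0 : 0 < del by rewrite lt_min eps0 /=; lra.
have del1 : del <= 2^-1 by rewrite ge_min lexx orbT.
have del_le : del <= eps by rewrite ge_min lexx.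
near=> t; have h0 : 0 < incr b t by near: t; exact: incr_gt0.
apply: lt_le_trans del_le.
rewrite distrC ltr_distl ltr_pdivlMr // ltr_pdivrMr //; apply/andP; split; near: t.
  by apply: incr_ratio_gt => //; lra.
by apply: incr_ratio_lt => //; lra.
Unshelve. all: by end_near. Qed.

Lemma incr_geom_cvg1 b n : 1 < b ->
  incr b (b ^+ n * t) / incr b t @[t --> +oo] --> (1 : R).
Proof.
move=> b1; have b0 : 0 < b by lra.
elim: n => [|n IHn].
  apply: cvg_near_cst; near=> t.
  by rewrite mul1r divff // gt_eqF //; near: t; exact: incr_gt0.
have bn0 : 0 < b ^+ n by rewrite exprn_gt0.
have : incr b (b * (b ^+ n * t)) / incr b (b ^+ n * t) @[t --> +oo] --> (1 : R).
  apply: (@cvg_comp _ _ _ (fun t => b ^+ n * t) _ _ +oo) (incr_ratio_cvg1 b1).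
  exact: gt0_cvgMry bn0 (fun A => id).
move=> /cvgM/(_ IHn); rewrite mulr1; apply: cvg_trans; apply: near_eq_cvg; near=> t.
rewrite /= exprS -[b * _ * t]mulrA [LHS]mulrA divfK // gt_eqF //; near: t.
exact: near_pinfty_scale bn0 (incr_gt0 b1).
Unshelve. all: by end_near. Qed.

Lemma incr_exp_cvg b n : 1 < b ->
  incr (b ^+ n) t / incr b t @[t --> +oo] --> (n%:R : R).
Proof.
move=> b1; elim: n => [|n IHn].
  apply: cvg_near_cst; near=> t.
  by rewrite /incr mul1r subrr mul0r.
rewrite -natr1; have sum_cvg : incr (b ^+ n) t / incr b t +
    incr b (b ^+ n * t) / incr b t @[t --> +oo] --> (n%:R + 1 : R).
  exact: cvgD IHn (incr_geom_cvg1 n b1).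
apply: cvg_trans sum_cvg; apply: near_eq_cvg; near=> t => /=.
by rewrite -mulrDl /incr exprS -mulrA; congr (_ / _); ring.
Unshelve. all: by end_near. Qed.

Lemma incr_exp_near b n : 1 < b -> \forall t \near +oo,
  (n%:R - 1) * incr b t < incr (b ^+ n) t /\ incr (b ^+ n) t < (n%:R + 1) * incr b t.
Proof.
move=> b1; have /cvgrPdist_lt/(_ 1 ltr01) near1 := @incr_exp_cvg b n b1.
near=> t; have h0 : 0 < incr b t by near: t; exact: incr_gt0.
have : `|n%:R - incr (b ^+ n) t / incr b t| < 1 by near: t.
by rewrite distrC ltr_distl ltr_pdivlMr // ltr_pdivrMr // => /andP.
Unshelve. all: by end_near. Qed.

(** If [2 ^+ p <= y ^+ q <= 2 ^+ p.+1] then, up to an error of 1 in each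
    coefficient, [p * incr 2 t <= q * incr y t <= p.+1 * incr 2 t]; here q is
    taken large with respect to 1 / eps. *)
Lemma incr_cvg_log y : 1 < y ->
  incr y t / incr 2 t @[t --> +oo] --> ln y / ln 2.
Proof.
move=> y1; have y0 : 0 < y by lra.
have two0 : 0 < (2 : R) by [].
have two1 : 1 < (2 : R) by lra.
have ln2 : 0 < ln (2 : R) by rewrite ln_gt0 //; lra.
have lny : 0 < ln y by rewrite ln_gt0.
set l := ln y / ln 2; have l0 : 0 < l by rewrite divr_gt0.
apply/cvgrPdist_lt => eps eps0.
pose q := (Num.bound ((2 + l) / eps)).+2.
have q1 : 0 < (q%:R - 1 : R) by rewrite subr_gt0 ltr1n.
have lt_q : (2 + l) / eps < q%:R - 1.
  have -> : q%:R - 1 = (Num.bound ((2 + l) / eps)).+1%:R :> R.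
    by rewrite /q -[in LHS]natr1 addrK.
  by rewrite (lt_trans (unstable.ltr_bound _)) // ltr_nat.
clearbody q; pose p := Num.trunc (q%:R * l).
have /andP[le_p lt_p] : p%:R <= q%:R * l < p.+1%:R.
  by apply: truncn_itv; rewrite mulr_ge0 // ltW.
clearbody p; have lnyq : ln (y ^+ q) = q%:R * l * ln 2.
  by rewrite lnXn // /l -mulrA divfK ?gt_eqF // mulr_natl.
have le_yq : 2 ^+ p <= y ^+ q.
  by rewrite -ler_ln ?posrE ?exprn_gt0 // lnyq lnXn // -[leLHS]mulr_natl ler_pM2r.
have ge_yq : y ^+ q <= 2 ^+ p.+1.
  by rewrite -ler_ln ?posrE ?exprn_gt0 // lnyq lnXn // -[leRHS]mulr_natl ler_pM2r // ltW.
near=> t.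
have t0 : 0 <= t by near: t; apply: nbhs_pinfty_ge; rewrite num_real.
have h0 : 0 < incr 2 t by near: t; exact: incr_gt0.
have [k1 k2] : (q%:R - 1) * incr y t < incr (y ^+ q) t /\
    incr (y ^+ q) t < (q%:R + 1) * incr y t by near: t; exact: incr_exp_near.
have [k3 _] : (p%:R - 1) * incr 2 t < incr (2 ^+ p) t /\
    incr (2 ^+ p) t < (p%:R + 1) * incr 2 t by near: t; exact: incr_exp_near.
have [_ k4] : (p.+1%:R - 1) * incr 2 t < incr (2 ^+ p.+1) t /\
    incr (2 ^+ p.+1) t < (p.+1%:R + 1) * incr 2 t by near: t; exact: incr_exp_near.
have k5 : incr (2 ^+ p) t <= incr (y ^+ q) t.
  by rewrite lerB // g_nd // ler_wpM2r.
have k6 : incr (y ^+ q) t <= incr (2 ^+ p.+1) t.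
  by rewrite lerB // g_nd // ler_wpM2r.
clear le_yq ge_yq lnyq; move: lt_q; rewrite ltr_pdivrMr // => lt_q.
rewrite -natr1 in k4 lt_p.
rewrite distrC ltr_distl ltr_pdivlMr // ltr_pdivrMr //.
set h := incr 2 t in h0 k3 k4 *; set k := incr y t in k1 k2 *.
set Q : R := q%:R in q1 lt_q le_p lt_p k1 k2 *.
set P : R := p%:R in le_p lt_p k3 k4 *.
have low : (Q * l - 2) * h < (Q + 1) * k.
  have : (Q * l - 2) * h <= (P - 1) * h by rewrite ler_pM2r //; lra.
  lra.
have high : (Q - 1) * k < (Q * l + 2) * h.
  have : (P + 1 + 1) * h <= (Q * l + 2) * h by rewrite ler_pM2r //; lra.
  lra.
have eh : (2 + l) * h < eps * (Q - 1) * h by rewrite ltr_pM2r // mulrC.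
have Q1 : 0 < Q + 1 by lra.
apply/andP; split.
  rewrite -(ltr_pM2l Q1); apply: le_lt_trans low.
  have : 0 <= eps * h by rewrite mulr_ge0 ?ltW.
  lra.
rewrite -(ltr_pM2l q1); apply: lt_le_trans high _; lra.
Unshelve. all: by end_near. Qed.

End Growth.

(** * Definability of the logarithm *)
Section Miller.
Context {R : realType} {A : forall n : nat, set (set 'rV[R]_n)}.
Hypothesis omin : ominimal_structure A.

Lemma interval_germ (I : interval R) :
  (\forall t \near +oo, t \in I) \/ (\forall t \near +oo, t \notin I).
Proof.
case: I => [l [b x|[]]].
- right; near=> t; rewrite in_itv negb_and; apply/orP; right.
  have : x < t by near: t; apply: nbhs_pinfty_gt; rewrite num_real.
  by case: b => /= x_lt_t; rewrite -?ltNge -?leNgt // ltW.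
- by right; near=> t; rewrite in_itv /= andbF.
- case: l => [b x|[]].
  + left; near=> t; rewrite in_itv /= andbT.
    have : x < t by near: t; apply: nbhs_pinfty_gt; rewrite num_real.
    by case: b => //= /ltW.
  + by left; near=> t; rewrite in_itv.
  + by right; near=> t; rewrite in_itv.
Unshelve. all: by end_near. Qed.

Lemma definable_germ (P : R -> Prop) : definable_pred A 1 (fun e => P (e 0%N)) ->
  (\forall t \near +oo, P t) \/ (\forall t \near +oo, ~ P t).
Proof.
move=> /(osA_interval omin)[s sP].
have {sP} PE t : P t <-> exists2 I, I \in s & t \in I.
  have := congr1 (fun X => X (const_mx t)) sP => /=.
  by rewrite -[0%N]/(val (0 : 'I_1)) env_ord !mxE => ->.
suff [near_s|near_s] : (\forall t \near +oo, exists2 I, I \in s & t \in I) \/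
    (\forall t \near +oo, forall I, I \in s -> t \notin I).
- by left; apply: filterS near_s => t /PE.
- by right; apply: filterS near_s => t nI /PE[I /nI/negP].
elim: s {PE} => [|I s [IHs|IHs]]; first by right; near=> t.
  by left; apply: filterS IHs => t [J Js tJ]; exists J; rewrite // inE Js orbT.
have [near_I|near_I] := interval_germ I; [left|right].
  by apply: filterS near_I => t tI; exists I => //; rewrite inE eqxx.
near=> t => J; rewrite inE => /predU1P[->|]; first by near: t.
by move: J; near: t.
Unshelve. all: by end_near. Qed.

Lemma formula_germ (f : lformula R) (P : R -> Prop) : wf_formula A 1 f ->
  (forall e, holds 1 e f <-> P (e 0%N)) ->
  (\forall t \near +oo, P t) \/ (\forall t \near +oo, ~ P t).
Proof.
by move=> /(definable_formula omin)/eq_definable df fP; apply: definable_germ; apply: df.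
Qed.

Lemma formula_function (f : lformula R) (g : R -> R) : wf_formula A 2 f ->
  (forall e, holds 2 e f <-> e 1%N = g (e 0%N)) -> definable_function A g.
Proof.
move=> /(definable_formula omin)/eq_definable df fg; have := df _ fg.
by congr (A _); apply/seteqP; split=> u /=; rewrite -!env_ord.
Qed.

Lemma not_ltE (x y : R) : (~ (x < y)) = (y <= x).
Proof. by apply/propext; rewrite leNgt; split=> /negP. Qed.

Definition TSub (s1 s2 : lterm R) := TAdd s1 (TMul (TCst (- 1)) s2).

Lemma exists_superpolynomial : ~ polynomially_bounded A ->
  exists2 f, definable_function A f & forall N, \forall t \near +oo, t ^+ N < f t.
Proof.
move=> /existsNP[f /not_implyP[df /forallNP f_large]].
pose absf := FOr (FAnd (FNot (FLt (TApp f (TVar 0)) (TCst 0))) (FEq (TVar 1) (TApp f (TVar 0))))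
  (FAnd (FLt (TApp f (TVar 0)) (TCst 0)) (FEq (TVar 1) (TSub (TCst 0) (TApp f (TVar 0))))).
have dabs : definable_function A (fun t => `|f t|).
  apply: (@formula_function absf); first by repeat split.
  move=> e /=; rewrite mulN1r sub0r; have [f0|f0] := ltrP (f (e 0%N)) 0.
    by rewrite ltr0_norm //; split=> [[[/(_ isT)]|[]]|->] //; right.
  by rewrite ger0_norm //; split=> [[[]|[]]|->] //; left.
exists (fun t => `|f t|) => // N.
pose pow := iter N (TMul (TVar 0)) (TCst 1 : lterm R).
have wf_pow : wf_term (A := A) 1 pow by rewrite /pow; elim: N {pow}.
have eval_pow e : eval e pow = e 0%N ^+ N.
  by rewrite /pow; elim: N {pow wf_pow} => [|N /= ->]; rewrite ?expr0 ?exprS.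
have [|||near_ge] := @formula_germ (FLt pow (TApp (fun t => `|f t|) (TVar 0)))
  (fun t => t ^+ N < `|f t|).
- by repeat split.
- by move=> e /=; rewrite eval_pow.
- by [].
case: (f_large N); apply: filterS near_ge => t.
by move=> /negP; rewrite -leNgt.
Qed.

Section GeneralisedInverse.
Variable f : R -> R.
Hypothesis df : definable_function A f.
Hypothesis f_large : forall N, \forall t \near +oo, t ^+ N < f t.

Let S (t : R) := [set x : R | 0 <= x /\ (x = 0 \/ f x <= t)].

(** The point 0 is put in every set S t so that the supremum is meaningful for
    all t. *)
Definition ginv (t : R) := sup (S t).

Let S_bounded N : exists2 M : R, 0 <= M &
  forall t x, S t x -> x <= M \/ x ^+ N <= t.
Proof.
have [M M0 gtM] := near_pinfty_from 0 (f_large N).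
exists M; first exact: ltW.
move=> t x [x0 [->|fx]]; first by left; exact: ltW.
have [xM|xM] := leP x M; [by left|right].
by apply/ltW/(lt_le_trans _ fx)/gtM/ltW.
Qed.

Let S_has_sup t : has_sup (S t).
Proof.
split; first by exists 0; split=> //; left.
have [M M0 SM] := S_bounded 1.
exists (Num.max M t) => x /SM; rewrite expr1 le_max => -[->//|->].
by rewrite orbT.
Qed.

Lemma ginv_nd : {homo ginv : x y / x <= y}.
Proof.
move=> x y le_xy; apply: le_sup => //; [|by have [] := S_has_sup x].
move=> z [z0 Sz]; exists z; split=> //.
by split=> //; case: Sz => [->|fz]; [left|right; exact: le_trans le_xy].
Qed.

Lemma ginv_unbounded M : exists t, M < ginv t.
Proof.
exists (f (`|M| + 1)); apply: lt_le_trans (_ : `|M| + 1 <= _).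
  by rewrite ltr_pwDr // ler_norm.
by apply: sup_upper_bound => //; split; [rewrite addr_ge0|right].
Qed.

(** For some M, every x > M in the set S t satisfies [x ^+ N.+1 < f x <= t]. *)
Lemma ginv_slow N : \forall t \near +oo, ginv t ^+ N <= t.
Proof.
have [M M0 SM] := S_bounded N.+1.
near=> t.
have t1 : 1 <= t by near: t; apply: nbhs_pinfty_ge; rewrite num_real.
have Mt : M ^+ N.+1 <= t by near: t; apply: nbhs_pinfty_ge; rewrite num_real.
have S_le x : S t x -> x ^+ N.+1 <= t.
  move=> Sx; have [xM|//] := SM _ _ Sx; apply: le_trans Mt.
  by apply: lerXn2r; rewrite ?nnegrE //; have [] := Sx.
have t0 : 0 < t by rewrite (lt_le_trans ltr01).
pose r := t `^ (N.+1%:R^-1).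
have rE : r ^+ N.+1 = t.
  by rewrite -powR_mulrn ?powR_ge0 // -powRrM mulVf ?powRr1 ?pnatr_eq0 // ltW.
have gr : ginv t <= r.
  apply: ge_sup; first by have [] := S_has_sup t.
  move=> x Sx; rewrite -(@ler_pXn2r _ N.+1) ?nnegrE ?powR_ge0 ?rE //; first exact: S_le.
  by have [] := Sx.
have g0 : 0 <= ginv t by apply: sup_upper_bound => //; split=> //; left.
have r1 : 1 <= r.
  by rewrite -(@ler_pXn2r _ N.+1) ?nnegrE ?powR_ge0 // rE expr1n.
apply: le_trans (_ : r ^+ N <= _).
  by apply: lerXn2r; rewrite ?nnegrE ?powR_ge0.
by rewrite -[leRHS]rE ler_weXn2l.
Unshelve. all: by end_near. Qed.

Lemma ginv_definable : definable_function A ginv.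
Proof.
pose inS i := FAnd (FNot (FLt (TVar i) (TCst 0)))
  (FOr (FEq (TVar i) (TCst 0)) (FNot (FLt (TVar 0) (TApp f (TVar i))))).
pose F := FAnd (FNot (FEx (FAnd (inS 2%N) (FLt (TVar 1) (TVar 2)))))
  (FNot (FEx (FAnd (FLt (TVar 2) (TVar 1))
     (FNot (FEx (FAnd (inS 3%N) (FLt (TVar 2) (TVar 3)))))))).
apply: (@formula_function F); first by repeat split.
move=> e /=; rewrite /upd /=; set t := e 0%N; set y := e 1%N.
have inSE x : (~ x < 0) /\ (x = 0 \/ ~ (t < f x)) <-> S t x.
  by rewrite !not_ltE.
split.
  move=> [ub lub]; apply/eqP; rewrite eq_le; apply/andP; split.
    rewrite leNgt; apply/negP => lt_y; apply: lub; exists (ginv t).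
    split=> // -[x [/inSE Sx]]; apply/negP; rewrite -leNgt.
    exact: sup_upper_bound.
  apply: ge_sup; first by have [] := S_has_sup t.
  move=> x /inSE Sx; rewrite leNgt; apply/negP => lt_yx.
  by apply: ub; exists x.
move=> ->; split=> [[x [/inSE Sx]]|[z [lt_z]]].
  by apply/negP; rewrite -leNgt; exact: sup_upper_bound.
apply; have [|x Sx] := @sup_adherent _ (S t) (ginv t - z) _ (S_has_sup t).
  by rewrite subr_gt0.
by rewrite opprB addrCA subrr addr0 => lt_zx; exists x; split=> //; apply/inSE.
Qed.

Lemma ginv_tame b c d :
  (\forall t \near +oo, c * incr ginv b t < d * incr ginv b (b * t)) \/
  (\forall t \near +oo, d * incr ginv b (b * t) <= c * incr ginv b t).
Proof.
have dg := ginv_definable.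
pose F := FLt (TMul (TCst c) (TSub (TApp ginv (TMul (TCst b) (TVar 0))) (TApp ginv (TVar 0))))
  (TMul (TCst d) (TSub (TApp ginv (TMul (TCst b) (TMul (TCst b) (TVar 0))))
    (TApp ginv (TMul (TCst b) (TVar 0))))).
have [||near_lt|near_ge] := @formula_germ F
  (fun t => c * incr ginv b t < d * incr ginv b (b * t)).
- by repeat split.
- by move=> e /=; rewrite !mulN1r.
- by left.
by right; apply: filterS near_ge => t /negP; rewrite -leNgt.
Qed.

End GeneralisedInverse.

(** For x > 1 the logarithm is the value of y for which [incr g x t] is between
    [(y / ln 2 - eps) * incr g 2 t] and [(y / ln 2 + eps) * incr g 2 t] for all
    large t, whatever eps > 0; for x < 1 it is obtained from 1 / x. *)
Lemma ln_definable : ~ polynomially_bounded A -> definable_function A (@ln R).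
Proof.
move=> /exists_superpolynomial[f df f_large].
pose g := ginv f.
have dg : definable_function A g by exact: ginv_definable.
have h_gt0 : \forall t \near +oo, 0 < incr g 2 t.
  apply: (incr_gt0 (ginv_nd f_large) (ginv_unbounded f_large) (ginv_tame df f_large)).
  by rewrite ltr1n.
have log_cvg := incr_cvg_log (ginv_nd f_large) (ginv_unbounded f_large)
  (ginv_slow f_large) (ginv_tame df f_large).
(* Written as the formula below evaluates, hence the factors -1. *)
pose close x y eps t :=
  (y * (ln 2)^-1 + -1 * eps) * (g (2 * t) + -1 * g t) < g (x * t) + -1 * g t /\
  g (x * t) + -1 * g t < (y * (ln 2)^-1 + eps) * (g (2 * t) + -1 * g t).
pose is_log x y := ~ (exists eps, 0 < eps /\
  ~ (exists T, ~ (exists t, T < t /\ ~ close x y eps t))).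
have is_logP x y : 1 < x -> is_log x y <-> y = ln x.
  move=> x1; have ln2 : ln (2 : R) != 0 by rewrite gt_eqF // ln_gt0 //; lra.
  have close_dist eps t : 0 < incr g 2 t ->
      close x y eps t <-> `|y / ln 2 - incr g x t / incr g 2 t| < eps.
    move=> h0; rewrite distrC ltr_distl ltr_pdivlMr // ltr_pdivrMr // /close /incr !mulN1r.
    by split=> /andP.
  split=> [lim_y|yE].
    apply: (mulIf (invr_neq0 ln2)).
    apply: (cvg_unique (F := incr g x t / incr g 2 t @[t --> +oo])
      (@norm_hausdorff R R)); last exact: log_cvg.
    apply/cvgrPdist_lt => eps eps0.
    have {lim_y} [T /forallNP far] : exists T, ~ (exists t, T < t /\ ~ close x y eps t).
      by apply: contrapT => noT; apply: lim_y; exists eps.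
    near=> t; apply/close_dist; first by near: t; exact: h_gt0.
    apply: contrapT => ncl; apply: (far t); split=> //.
    by near: t; apply: nbhs_pinfty_gt; rewrite num_real.
  move=> [eps [eps0]]; apply.
  have := log_cvg x x1; rewrite -yE => /cvgrPdist_lt/(_ eps eps0) near_log.
  have [|T _ closeT] := @near_pinfty_from R (close x y eps) 0.
    near=> t; apply/close_dist; first by near: t; exact: h_gt0.
    by near: t.
  by exists T => -[t [/ltW/closeT]].
pose F (x y : lterm R) (i : nat) :=
  let k s := TSub (TApp g (TMul s (TVar i.+2))) (TApp g (TVar i.+2)) in
  let l := TMul y (TCst (ln 2)^-1) in
  FNot (FEx (FAnd (FLt (TCst 0) (TVar i)) (FNot (FEx (FNot (FEx
    (FAnd (FLt (TVar i.+1) (TVar i.+2)) (FNot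
     (FAnd (FLt (TMul (TSub l (TVar i)) (k (TCst 2))) (k x))
           (FLt (k x) (TMul (TAdd l (TVar i)) (k (TCst 2))))))))))))).
pose Fln :=
  FOr (FAnd (FNot (FLt (TCst 0) (TVar 0))) (FEq (TVar 1) (TCst 0)))
 (FOr (FAnd (FEq (TVar 0) (TCst 1)) (FEq (TVar 1) (TCst 0)))
 (FOr (FAnd (FLt (TCst 1) (TVar 0)) (F (TVar 0) (TVar 1) 2%N))
      (FAnd (FLt (TVar 0) (TCst 1)) (FEx (FAnd (FEq (TMul (TVar 0) (TVar 2)) (TCst 1))
        (FAnd (FLt (TCst 1) (TVar 2)) (F (TVar 2) (TMul (TCst (-1)) (TVar 1)) 3%N))))))).
apply: (@formula_function Fln); first by repeat split.
move=> e /=; rewrite /upd /=; set x := e 0%N; set y := e 1%N.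
(* [ln x] is 0 for x <= 0. *)
have -> : (~ (0 < x) /\ y = 0 \/ x = 1 /\ y = 0 \/ 1 < x /\ is_log x y \/
  x < 1 /\ (exists z, x * z = 1 /\ 1 < z /\ is_log z (-1 * y))) <-> y = ln x; last by [].
split.
  move=> [[/negP]|[[->]|[[x1]|[x1 [z [xz [z1]]]]]]].
  - by rewrite -leNgt => /ln0 ->.
  - by rewrite ln1.
  - by move/(is_logP _ _ x1).
  have z0 : 0 < z by lra.
  have x0 : 0 < x by rewrite -(pmulr_lgt0 _ z0) xz.
  move/(is_logP _ _ z1) => yE; have := congr1 (@ln R) xz.
  by rewrite lnM ?posrE // ln1 -yE; lra.
move=> ->; have [x0|x0] := leP x 0; first by left; split; [|exact: ln0].
right; have [x1|x1|->] := ltrgtP x 1.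
- right; right; split=> //; exists x^-1.
  have z1 : 1 < x^-1 by rewrite invf_gt1.
  by rewrite mulfV ?gt_eqF //; do 2!split=> //; apply/is_logP => //; rewrite lnV ?posrE // mulN1r.
- by right; left; split=> //; apply/is_logP.
- by left; rewrite ln1.
Unshelve. all: by end_near. Qed.

End Miller.

(** * The surface in logarithmic form *)
Section Surface.
Context {R : realType}.
Implicit Types (x y z a s t w : R).

Definition surface x y z := [/\ 0 < x, 0 < z &
  y * ln x = z * (ln z - ln x) \/ - y * ln x = z * (ln z - ln x)].

Lemma point3E (u : 'rV[R]_(2 + 1)) x y z :
  u = point3 x y z <-> [/\ u 0 0 = x, u 0 1 = y & u 0 2%:R = z].
Proof.
split=> [->|[ux uy uz]]; first by split; rewrite mxE.
apply/rowP => i; rewrite mxE.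
case: i => [[|[|[|//]]] lti] /=; [rewrite -ux|rewrite -uy|rewrite -uz];
  by congr (u _ _); apply/val_inj.
Qed.

(** For x <> 1 the exponent is [a + 1 = ln z / ln x]; for x = 1 both sides say
    z = 1 and leave y free. *)
Lemma power_logE x y z :
  (exists a, [/\ 0 < x, y = a * x `^ (a + 1) & z = x `^ (a + 1)]) <->
  [/\ 0 < x, 0 < z & y * ln x = z * (ln z - ln x)].
Proof.
split=> [[a [x0 -> ->]]|[x0 z0]].
  by split=> //; [exact: powR_gt0|rewrite ln_powR; ring].
have [->|x1] := eqVneq x 1.
  rewrite ln1 mulr0 subr0 => /esym/eqP.
  rewrite mulf_eq0 gt_eqF //= ln_eq0 // => /eqP ->.
  by exists y; split; rewrite ?powR1 ?mulr1.
have lnx : ln x != 0 by rewrite ln_eq0.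
move=> yE; have zE : z = x `^ (ln z / ln x - 1 + 1).
  by rewrite subrK /powR gt_eqF // divfK // lnK ?posrE.
exists (ln z / ln x - 1); split=> //.
rewrite -zE; apply: (mulIf lnx); rewrite yE; field.
exact: lnx.
Qed.

Lemma surfaceE (u : 'rV[R]_(2 + 1)) :
  (X1 (R:=R) `|` X2 (R:=R)) u <-> surface (u 0 0) (u 0 1) (u 0 2%:R).
Proof.
split.
- move=> [[x [a [x0 /point3E[-> -> ->]]]]|[x [a [x0 /point3E[-> -> ->]]]]].
    have /power_logE[? ? ?] : exists b, [/\ 0 < x, a * x `^ (a + 1) = b * x `^ (b + 1) &
      x `^ (a + 1) = x `^ (b + 1)] by exists a.
    by split=> //; left.
  have /power_logE[? ? ?] : exists b, [/\ 0 < x, a * x `^ (a + 1) = b * x `^ (b + 1) &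
    x `^ (a + 1) = x `^ (b + 1)] by exists a.
  by split=> //; right; rewrite (mulNr a) opprK.
- move=> [x0 z0 [yE|yE]]; [left|right].
    have /power_logE[a [_ yE' zE]] := And3 x0 z0 yE.
    by exists (u 0 0), a; split=> //; apply/point3E.
  have /power_logE[a [_ yE' zE]] := And3 x0 z0 yE.
  exists (u 0 0), a; split=> //; apply/point3E; split=> //.
  by rewrite mulNr -yE' opprK.
Qed.

Lemma surface_definable (A : forall n : nat, set (set 'rV[R]_n)) :
  ominimal_structure A -> definable_function A (@ln R) ->
  A (2 + 1)%N (X1 (R:=R) `|` X2 (R:=R)).
Proof.
move=> omin dln.
pose L i : lterm R := TApp (@ln R) (TVar i).
pose rhs := TMul (TVar 2) (TSub (L 2%N) (L 0%N)).
pose F := FAnd (FLt (TCst 0) (TVar 0)) (FAnd (FLt (TCst 0) (TVar 2))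
  (FOr (FEq (TMul (TVar 1) (L 0%N)) rhs)
       (FEq (TMul (TMul (TCst (- 1)) (TVar 1)) (L 0%N)) rhs))).
have wfF : wf_formula A 3 F by repeat split.
have := definable_formula omin wfF; congr (A _).
apply/seteqP; split=> u /=; rewrite !mulN1r -[0%N]/(val (0 : 'I_3))
  -[1%N]/(val (1 : 'I_3)) -[2%N]/(val (2%:R : 'I_3)) !env_ord.
  by move=> [x0 [z0 yE]]; apply/surfaceE.
by move=> /surfaceE[x0 z0 yE].
Qed.

End Surface.

(** * Failure of the regular projection theorem *)
Section Irregular.
Context {R : realType}.
Implicit Types (x y z a s t w : R).

(** The mean value theorem for [ln \o phi]. *)
Lemma log_lipschitz (phi dphi : R -> R) C a b : a < b ->
  (forall s, a <= s <= b -> 0 < phi s) ->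
  (forall s, a <= s <= b -> is_derive s (1 : R) phi (dphi s)) ->
  (forall s, a <= s <= b -> `|dphi s| <= C * phi s) ->
  `|ln (phi b) - ln (phi a)| <= C * (b - a).
Proof.
move=> lt_ab phi0 dphiE dphi_le.
have dln s : a <= s <= b -> is_derive s (1 : R) (@ln R \o phi) ((phi s)^-1 * dphi s).
  by move=> sab; exact: is_derive1_comp (is_derive1_ln (phi0 s sab)) (dphiE s sab).
have [||c cab ->] := @MVT R (@ln R \o phi) (fun s => (phi s)^-1 * dphi s) a b lt_ab.
- by move=> s; rewrite in_itv /= => /andP[/ltW sa /ltW sb]; apply: dln; rewrite sa.
- apply: derivable_within_continuous => s; rewrite in_itv /= => sab.
  by have [] := dln s sab.
have {}cab : a <= c <= b by move: cab; rewrite in_itv /= => /andP[/ltW -> /ltW ->].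
rewrite normrM [`|b - a|]gtr0_norm ?subr_gt0 // ler_pM2r ?subr_gt0 //.
rewrite normrM gtr0_norm ?invr_gt0 ?phi0 // mulrC ler_pdivrMr ?phi0 //.
exact: dphi_le.
Qed.

Lemma is_derive_partial m (j : 'I_m) (f : 'rV[R]_m -> R) (v : 'rV[R]_m) s :
  derivable f (v + s *: delta_mx 0 j) (delta_mx 0 j) ->
  is_derive s (1 : R) (fun s => f (v + s *: delta_mx 0 j))
    (partial j f (v + s *: delta_mx 0 j)).
Proof.
move=> df; set phi := fun s => _; set l := v + _.
have quotE : (fun h : R => h^-1 *: (phi (h *: 1 + s) - phi s)) =
             (fun h : R => h^-1 *: (f (h *: delta_mx 0 j + l) - f l)).
  apply/funext => h; congr (_ *: (f _ - _)).
  by rewrite [h *: 1]mulr1 scalerDl addrCA.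
split; first by rewrite /derivable /= quotE.
by rewrite /partial /derive /= quotE.
Qed.

Lemma partial_le_enorm_grad m (j : 'I_m) (f : 'rV[R]_m -> R) (u : 'rV[R]_m) :
  `|partial j f u| <= enorm (grad f u).
Proof.
rewrite /enorm -sqrtr_sqr ler_wsqrtr // (bigD1 j) //= mxE.
by rewrite lerDl sumr_ge0 // => i _; exact: sqr_ge0.
Qed.

Lemma enorm_delta m (j : 'I_m) s : enorm (s *: delta_mx 0 j : 'rV[R]_m) = `|s|.
Proof.
rewrite /enorm (bigD1 j) //= big1 ?addr0 => [|i /negPf ne_ij].
  by rewrite !mxE !eqxx mulr1 sqrtr_sqr.
by rewrite !mxE ne_ij andbF mulr0 expr0n.
Qed.

Lemma dirE (P : 'rV[R]_(2 + 1)) t (v : 'rV[R]_2) :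
  [/\ (P + t *: dir v) 0 0 = P 0 0 + t * v 0 0,
      (P + t *: dir v) 0 1 = P 0 1 + t * v 0 1 &
      (P + t *: dir v) 0 2%:R = P 0 2%:R + t].
Proof.
have E0 (M : 'rV[R]_(2 + 1)) : M 0 0 = M 0 (lshift 1 (0 : 'I_2)).
  by congr (M _ _); apply/val_inj.
have E1 (M : 'rV[R]_(2 + 1)) : M 0 1 = M 0 (lshift 1 (1 : 'I_2)).
  by congr (M _ _); apply/val_inj.
have E2 (M : 'rV[R]_(2 + 1)) : M 0 2%:R = M 0 (rshift 2 (0 : 'I_1)).
  by congr (M _ _); apply/val_inj.
rewrite !E0 !E1 !E2; split; rewrite [LHS]mxE [X in _ + X]mxE /dir ?row_mxEl ?row_mxEr //.
by rewrite mxE eqxx mulr1.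
Qed.

Lemma expR_sub1 w : expR (w - 1) <= expR w / 2.
Proof.
have := expR_ge1Dx (1 : R); rewrite expRD expRN => e1.
by rewrite ler_pM2l ?expR_gt0 // lef_pV2 ?posrE ?expR_gt0 //; lra.
Qed.

Lemma expR_add1 w : expR w * 2 <= expR (w + 1).
Proof. by have := expR_sub1 (w + 1); rewrite addrK; lra. Qed.

(** With x0 = expR w and x = expR y, this is a solution of x = x0 + v1 x^e with
    x / x0 between expR (-1) and expR 1, from the intermediate value theorem. *)
Lemma line_meets_power v1 e w : 0 <= e ->
  `|v1| * expR (e * (w + 1)) <= expR w / 2 ->
  exists2 y, w - 1 <= y <= w + 1 & expR y = expR w + v1 * expR (e * y).
Proof.
move=> e0 small.
have bound y : y <= w + 1 -> `|v1 * expR (e * y)| <= expR w / 2.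
  move=> le_y; apply: le_trans small; rewrite normrM ler_wpM2l //.
  by rewrite gtr0_norm ?expR_gt0 // ler_expR ler_wpM2l.
pose psi y := expR y - v1 * expR (e * y).
have [|||y] := @IVT R psi (w - 1) (w + 1) (expR w).
- lra.
- apply: continuous_subspaceT => y; apply: cvgB; first exact: continuous_expR.
  apply: cvgMr; apply: continuous_comp; last exact: continuous_expR.
  by apply: cvgMr; exact: cvg_id.
- have /bound : w - 1 <= w + 1 by lra.
  have /bound := lexx (w + 1).
  rewrite /psi !ler_norml => /andP[_ up] /andP[lo _].
  have := expR_sub1 w; have := expR_add1 w; have := expR_gt0 w => w0 ge_w le_w.
  by rewrite ge_min le_max; apply/andP; split; apply/orP; [left|right]; lra.
by rewrite in_itv /= => yw yE; exists y => //; rewrite -yE /psi subrK.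
Qed.

(** Here y, z and T are the logarithms of the abscissa at the first direction,
    and of the abscissa and the height at the second one; a and a + del are the
    absolute values of the second coordinates of the two directions.  If
    [T = (1 + (a + del)) * z] then T is below [(1 + a) * y] by about
    [- del * w]; if [T = (1 - (a + del)) * z] then T is above it by at least
    about [- a * w]. *)
Lemma log_contradiction m a del D w y z T : 0 <= m -> 0 < del -> del <= a -> 0 <= D ->
  w < -1 -> del * w < - (m + D + 2 * del + 2 + 2 * a) ->
  w - 1 <= y <= w + 1 -> w - 1 <= z <= w + 1 ->
  `|T - (1 + a) * y| <= D ->
  T = (1 + (a + del)) * z \/ T = (1 - (a + del)) * z -> False.
Proof.
move=> m0 del0 le_a D0 w1 delw /andP[y1 y2] /andP[z1 z2].
have aw : a * w <= del * w by rewrite ler_wnM2r //; lra.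
rewrite ler_norml => /andP[T1 T2] [TE|TE].
  have : (1 + a + del) * z <= (1 + a + del) * (w + 1) by rewrite ler_pM2l //; lra.
  have : (1 + a) * (w - 1) <= (1 + a) * y by rewrite ler_pM2l //; lra.
  lra.
have : (a + del) * z <= 0 by rewrite mulr_ge0_le0 //; lra.
have : (1 + a) * y <= (1 + a) * (w + 1) by rewrite ler_pM2l //; lra.
lra.
Qed.

(** The two directions compared are [v + u0 *: delta_mx 0 1] and
    [v + u1 *: delta_mx 0 1], at distances eps / 4 and eps / 2 from v and moved
    away from the axis v2 = 0, so that both second coordinates are nonzero, of
    sign [sg].  The sheet [f i] is the one through the small solution at the first
    direction; the Lipschitz bound keeps it small at the second one. *)
Lemma irregular_near (eps C : R) p (v : 'rV[R]_2) : 0 < eps -> 0 < C -> (0 < p)%N ->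
  exists W, forall w, w < W ->
    ~ regular_projection eps C p (X1 (R:=R) `|` X2 (R:=R)) (point3 (expR w) 0 0) v.
Proof.
move=> eps0 C0; case: p => // p _.
pose v1 := v 0 0; pose v2 := v 0 1; pose del := eps / 4; pose a0 := `|v2| + del.
pose m := ln (2 * `|v1| + 1); pose D := C * del.
have del0 : 0 < del by rewrite divr_gt0.
have le_a0 : del <= a0 by rewrite lerDr.
have D0 : 0 <= D by rewrite mulr_ge0 ?ltW.
have v1_ge0 : 0 <= `|v1| by [].
have m0 : 0 <= m by rewrite ln_ge0 //; lra.
have v1_le : `|v1| <= expR m / 2 by rewrite lnK ?posrE; lra.
exists (- (1 + (m + D + 2 * del + 2 + 2 * a0) / del)) => w ltw [_ [k [f [fC _ _ fX fgrad]]]].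
have S0 : 0 <= m + D + 2 * del + 2 + 2 * a0 by lra.
have w1 : w < -1.
  have : 0 <= (m + D + 2 * del + 2 + 2 * a0) / del by rewrite divr_ge0 // ltW.
  lra.
have delw : del * w < - (m + D + 2 * del + 2 + 2 * a0).
  have : (m + D + 2 * del + 2 + 2 * a0) / del < - w by lra.
  by rewrite ltr_pdivrMr //; lra.
have aw : a0 * w <= del * w by rewrite ler_wnM2r //; lra.
have small T : T <= D + (1 + a0) * (w + 1) -> `|v1| * expR T <= expR w / 2.
  move=> le_T; apply: le_trans (_ : expR m / 2 * expR T <= _).
    by rewrite ler_wpM2r // ltW // expR_gt0.
  by rewrite mulrAC -expRD ler_pM2r // ler_expR; lra.
have [y yw yE] : exists2 y, w - 1 <= y <= w + 1 &
    expR y = expR w + v1 * expR ((1 + a0) * y).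
  by apply: line_meets_power; [lra|apply: small; lra].
have [sg sg1 v2E] : exists2 sg : R, sg = 1 \/ sg = -1 & v2 = sg * `|v2|.
  have [v20|v20] := leP 0 v2; first by exists 1; [left|rewrite mul1r ger0_norm].
  by exists (-1); [right|rewrite ltr0_norm // mulN1r opprK].
pose P : 'rV[R]_(2 + 1) := point3 (expR w) 0 0.
have [P0 P1 P2] : [/\ P 0 0 = expR w, P 0 1 = 0 & P 0 2%:R = 0] by apply/point3E.
pose l u : 'rV[R]_2 := v + u *: delta_mx 0 1.
have l0 u : (l u) 0 0 = v1 by rewrite !mxE mulr0 addr0.
have l1 u : (l u) 0 1 = v2 + u by rewrite !mxE mulr1.
have l_ball u : `|u| < eps -> eball v eps (l u).
  by rewrite /eball /= /l addrC addKr enorm_delta.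
have f_surface i u : `|u| < eps ->
    surface (expR w + f i (l u) * v1) (f i (l u) * (v2 + u)) (f i (l u)).
  move=> /l_ball lu.
  have : (\bigcup_i cone_graph eps P v (f i)) (P + f i (l u) *: dir (l u)).
    by exists i => //; exists (l u).
  rewrite -fX => -[/surfaceE + _].
  have [-> -> ->] := dirE P (f i (l u)) (l u).
  by rewrite P0 P1 P2 l0 l1 !add0r.
have f_gt0 i u : `|u| < eps -> 0 < f i (l u) by move=> /(f_surface i)[].
have f_lip i a b : a < b -> - eps < a -> b < eps ->
    `|ln (f i (l b)) - ln (f i (l a))| <= C * (b - a).
  move=> lt_ab lt_a lt_b.
  have in_eps u : a <= u <= b -> `|u| < eps by move=> /andP[au ub]; rewrite ltr_norml; lra.
  apply: (@log_lipschitz (fun u => f i (l u)) (fun u => partial 1 (f i) (l u))) => // u /in_eps lu.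
  - exact: f_gt0.
  - apply: is_derive_partial; have [_ /(_ 1)[+ _]] := fC i.
    by apply; exact: l_ball.
  - apply: le_trans (partial_le_enorm_grad _ _ _) _.
    by rewrite -[X in C * X]gtr0_norm ?f_gt0 //; apply: fgrad; exact: l_ball.
pose t0 := expR ((1 + a0) * y); pose u0 := sg * del; pose u1 := sg * (2 * del).
have norm_sg s : `|sg * s| = `|s|.
  by case: sg1 => ->; rewrite ?mul1r // mulN1r normrN.
have u0_eps : `|u0| < eps by rewrite norm_sg gtr0_norm // /del; lra.
have u1_eps : `|u1| < eps by rewrite norm_sg gtr0_norm ?mulr_gt0 // /del; lra.
have vu0 : v2 + u0 = sg * a0 by rewrite {1}v2E -mulrDr.
have vu1 : v2 + u1 = sg * (a0 + del) by rewrite {1}v2E -mulrDr /a0; congr (_ * _); lra.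
(* Heights are third coordinates, so the height t0 determines the sheet. *)
have [i fi] : exists i, f i (l u0) = t0.
  have : ((X1 (R:=R) `|` X2 (R:=R)) `&` cone eps P v) (P + t0 *: dir (l u0)).
    split; last by exists t0, (l u0); split; [rewrite gt_eqF ?expR_gt0|exact: l_ball|].
    apply/surfaceE; have [-> -> ->] := dirE P t0 (l u0).
    rewrite P0 P1 P2 l0 l1 !add0r vu0 [t0 * v1]mulrC -yE; split; rewrite ?expR_gt0 //.
    rewrite !expRK; case: sg1 => ->; [left|right]; ring.
  rewrite fX => -[i _ [l' l'_ball /= eqP]]; exists i.
  have [e0 e1 e2] := dirE P (f i l') l'; have [g0 g1 g2] := dirE P t0 (l u0).
  rewrite eqP in e0 e1 e2.
  have tE : f i l' = t0 by move: g2; rewrite e2 => /addrI.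
  have t0_neq0 : t0 != 0 by rewrite gt_eqF ?expR_gt0.
  rewrite tE in e0 e1.
  suff -> : l u0 = l' by [].
  apply/rowP => -[[|[|//]] lt_j].
    have -> : Ordinal lt_j = 0 by apply/val_inj.
    by apply/(mulfI t0_neq0)/(addrI (P 0 0)); rewrite -g0 e0.
  have -> : Ordinal lt_j = 1 by apply/val_inj.
  by apply/(mulfI t0_neq0)/(addrI (P 0 1)); rewrite -g1 e1.
pose T := ln (f i (l u1)).
have T_near : `|T - (1 + a0) * y| <= D.
  rewrite /T -[(1 + a0) * y]expRK -/t0 -fi /D.
  have -> : del = 2 * del - del by lra.
  rewrite /u0 /u1; case: sg1 => ->; rewrite ?mul1r ?mulN1r.
    by apply: f_lip; rewrite /del; lra.
  rewrite distrC (_ : 2 * del - del = - del - - (2 * del)); last by lra.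
  by apply: f_lip; rewrite /del; lra.
have [x1_gt0 _ x1_eq] := f_surface i u1 u1_eps.
have fT : f i (l u1) = expR T by rewrite lnK // posrE f_gt0.
pose z := ln (expR w + f i (l u1) * v1).
have zw : w - 1 <= z <= w + 1.
  have /small : T <= D + (1 + a0) * (w + 1).
    have : (1 + a0) * y <= (1 + a0) * (w + 1) by rewrite ler_pM2l //; lra.
    by move: T_near; rewrite ler_norml => /andP[_]; lra.
  rewrite -fT -[X in _ * X]gtr0_norm ?f_gt0 // -normrM mulrC ler_norml => /andP[lo up].
  have := expR_sub1 w; have := expR_add1 w; have := expR_gt0 w => w0 ge_w le_w.
  by rewrite -(ler_expR (w - 1)) -(ler_expR z) lnK ?posrE //; lra.
apply: (log_contradiction m0 del0 le_a0 D0 w1 delw yw zw T_near).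
have cancel_f s : s * f i (l u1) = f i (l u1) * (T - z) -> T = z + s.
  rewrite [s * _]mulrC => /mulfI -> ; last by rewrite gt_eqF ?f_gt0.
  lra.
have [TE|TE] : T = z + (v2 + u1) * z \/ T = z - (v2 + u1) * z.
- case: x1_eq => eqT; [left|right]; apply: cancel_f; rewrite -eqT -/z; ring.
- by rewrite TE vu1; case: sg1 => ->; [left|right]; ring.
- by rewrite TE vu1; case: sg1 => ->; [right|left]; ring.
Qed.

Lemma irregular (eps C : R) p (V : set 'rV[R]_2) : 0 < eps -> 0 < C -> (0 < p)%N ->
  finite_set V -> exists P, forall v, V v ->
    ~ regular_projection eps C p (X1 (R:=R) `|` X2 (R:=R)) P v.
Proof.
move=> eps0 C0 p0 /finite_seqP[s ->].
suff [W ltW_irr] : exists W, forall w, w < W -> forall v, v \in s ->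
    ~ regular_projection eps C p (X1 (R:=R) `|` X2 (R:=R)) (point3 (expR w) 0 0) v.
  by exists (point3 (expR (W - 1)) 0 0) => v; apply: ltW_irr; lra.
elim: s => [|v s [W1 irr1]]; first by exists 0.
have [W2 irr2] := irregular_near v eps0 C0 p0.
exists (Num.min W1 W2) => w; rewrite lt_min => /andP[w1 w2] v'.
by rewrite inE => /predU1P[->|]; [exact: irr2|exact: irr1].
Qed.

End Irregular.

Theorem mainTheorem3 (R : realType) (A : forall n : nat, set (set 'rV[R]_n))
    (A_omin : ominimal_structure A) (A_npb : ~ polynomially_bounded A) :
  A (2 + 1)%N (X1 (R:=R) `|` X2 (R:=R)) /\
  forall p : nat, (0 < p)%N ->
    ~ exists (eps C : R) (V : set 'rV[R]_2),
        [/\ 0 < eps, 0 < C, finite_set V &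
            forall x : 'rV[R]_(2 + 1), exists v : 'rV[R]_2,
              V v /\ regular_projection eps C p (X1 (R:=R) `|` X2 (R:=R)) x v].
Proof.
split; first exact: surface_definable A_omin (ln_definable A_omin A_npb).
move=> p p0 [eps [C [V [eps0 C0 finV reg]]]].
have [P irr] := irregular eps0 C0 p0 finV.
by have [v [Vv /(irr v Vv)]] := reg P.
Qed.
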